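(* For all $n\geq 1$ and all $j,k\geq 2$ with $j<k$, $\mathsf{RT}^n_k \nleq_{\mathrm{sW}} \mathsf{RT}^n_j$.
   Context: For $n,k\geq1$, $\mathsf{RT}^n_k$ is the $\Pi^1_2$ principle whose instances are colorings $f:[\omega]^n\to k$ (where $[\omega]^n$ is the set of $n$-element subsets of $\omega$ and $k=\{0,\dots,k-1\}$) and whose solutions are infinite sets $H\subseteq\omega$ homogeneous for $f$, i.e. $f$ is constant on $[H]^n$. For $\Pi^1_2$ principles viewed as problems (instances and solutions), $\mathsf{P}\leq_{\mathrm{sW}}\mathsf{Q}$ means there are Turing functionals $\Phi,\Psi$ such that for every instance $A$ of $\mathsf{P}$, $\Phi(A)$ is an instance of $\mathsf{Q}$, and for every solution $T$ to $\Phi(A)$, $\Psi(T)$ is a solution to $A$. *)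

(* Defs.v *)
From mathcomp Require Import all_boot.
Set Implicit Arguments. Unset Strict Implicit. Unset Printing Implicit Defensive.

Definition cpair (x y : nat) : nat := ((x + y) * (x + y).+1)./2 + y.

(* ---------- Oracle partial recursive functionals (Turing functionals) ----------
   Unary partial functions nat -> nat relative to an oracle A : nat -> nat,
   multi-argument functions being coded through Cantor pairing.  This basis
   (constants, successor, identity, composition, pairing, projections,
   primitive recursion, minimisation, oracle query) generates exactly the
   partial A-recursive functions; a term is a Turing functional. *)
Inductive term : Type :=
| TConst of nat
| TSucc
| TId
| TOracle
| TComp of term & term
| TPair of term & term
| TFst
| TSnd
| TPrec of term & term
| TMu of term.

Inductive evalR (A : nat -> nat) : term -> nat -> nat -> Prop :=
| ev_const c x : evalR A (TConst c) x c
| ev_succ x : evalR A TSucc x x.+1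
| ev_id x : evalR A TId x x
| ev_oracle x : evalR A TOracle x (A x)
| ev_comp t1 t2 x y z : evalR A t2 x y -> evalR A t1 y z -> evalR A (TComp t1 t2) x z
| ev_pair t1 t2 x a b : evalR A t1 x a -> evalR A t2 x b -> evalR A (TPair t1 t2) x (cpair a b)
| ev_fst x y : evalR A TFst (cpair x y) x
| ev_snd x y : evalR A TSnd (cpair x y) y
| ev_prec0 g h x v : evalR A g x v -> evalR A (TPrec g h) (cpair x 0) v
| ev_precS g h x n v w :
    evalR A (TPrec g h) (cpair x n) v ->
    evalR A h (cpair (cpair x n) v) w ->
    evalR A (TPrec g h) (cpair x n.+1) w
| ev_mu t x y :
    evalR A t (cpair x y) 0 ->
    (forall z, z < y -> exists2 v, v != 0 & evalR A t (cpair x z) v) ->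
    evalR A (TMu t) x y.

Definition computes (Phi : term) (A B : nat -> nat) : Prop :=
  forall x, evalR A Phi x (B x).

(* ---------- Problems (Pi^1_2 principles) ----------
   Instances and solutions are elements of Baire space nat -> nat;
   sets X ⊆ nat are represented by their characteristic functions (0/1 valued). *)
Record problem := Problem {
  inst : (nat -> nat) -> Prop;
  sol : (nat -> nat) -> (nat -> nat) -> Prop  (* sol A T : T solves A *)
}.

Definition sW_reducible (P Q : problem) : Prop :=
  exists Phi Psi : term,
    forall A, inst P A ->
      exists B, computes Phi A B /\ inst Q B /\
        forall T, sol Q B T ->
          exists C, computes Psi T C /\ sol P A C.

(* combinatorial number system: the canonical bijection [omega]^n -> omega,
   {a_0 < ... < a_(n-1)} |-> sum_i C(a_i, i+1)  (for each fixed n >= 1) *)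
Definition code_set (s : seq nat) : nat :=
  \sum_(i < size s) 'C(nth 0 s i, i.+1).

Definition is_set (X : nat -> nat) : Prop := forall x, X x <= 1.
Definition infinite_set (X : nat -> nat) : Prop := forall m, exists2 x, m <= x & X x = 1.

Definition nsubset (n : nat) (X : nat -> nat) (s : seq nat) : Prop :=
  [/\ size s = n, sorted ltn s & all (fun x => X x == 1) s].

(* An instance of RT^n_k is a coloring f : [omega]^n -> k, presented (through the
   bijection code_set) as A : nat -> nat with values < k; f(s) = A (code_set s). *)
Definition RT (n k : nat) : problem :=
  Problem
    (fun A => forall x, A x < k)
    (fun A H => [/\ is_set H, infinite_set H &
                 exists c, forall s, nsubset n H s -> A (code_set s) = c]).

(* Main.v *)
Require Import Defs.
From mathcomp Require Import all_boot.
From mathcomp Require Import boolp classical_sets filter.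

(**
The argument only uses that the two functionals are continuous.  Fix a
nonprincipal ultrafilter on [nat], used to take limits in compact spaces.

A strong reduction is relaxed to a compact space of points [z], each naming a
[k]-coloring of [m]-tuples (every coloring being named), carrying a [j]-coloring
of [m]-tuples of an infinite domain, and such that homogeneous sets for the latter
are mapped continuously to homogeneous sets for the former.  From [m.+1] one passes
to [m] as follows: given a [k]-coloring [f] of [m]-tuples, build step by step a
[k]-coloring of [m.+1]-tuples with limit [f] in its last argument, deciding
along the way all open facts about the points over it, as in the low basis
theorem.  The decisions depend continuously on [f], so they bound the elements of
a prehomogeneous set for the [j]-coloring compactly in [f]; on such a set the
[j]-coloring only depends on the first [m] arguments.

For [m = 1], decide for each [c < j] and [i < k] whether some finite set of
color [c] makes the backward functional output an element of color [i].  Choose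
for each [c] one such [i], if there is any.  As [j < k], some color [i0] is not
chosen.  Extend the finite part of the [k]-coloring fixed so far by [i0] forever:
then a color [c] occurring infinitely often must allow the output [i0], hence also
the chosen [i <> i0], but infinite outputs can only have color [i0].
*)

Set Implicit Arguments. Unset Strict Implicit. Unset Printing Implicit Defensive.

(** * Increasing sequences and their combinatorial codes *)

Lemma sorted_rcons_ltn s y :
  sorted ltn (rcons s y) = sorted ltn s && all (fun x => x < y) s.
Proof.
rewrite -rev_sorted rev_rcons /= path_sortedE; last exact: rev_trans ltn_trans.
by rewrite all_rev andbC; congr (_ && _); rewrite -rev_sorted revK.
Qed.

Lemma code_set_rcons s a :
  code_set (rcons s a) = code_set s + 'C(a, (size s).+1).
Proof.
rewrite /code_set size_rcons big_ord_recr /= nth_rcons ltnn eqxx; congr (_ + _).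
by apply: eq_bigr => i _; rewrite nth_rcons ltn_ord.
Qed.

Lemma code_set_bound s b :
  sorted ltn s -> all (fun x => x < b) s -> code_set s < 'C(b, size s).
Proof.
elim/last_ind: s b => [|s a IH] b; first by rewrite /code_set big_ord0 bin0.
rewrite sorted_rcons_ltn all_rcons code_set_rcons size_rcons.
case/andP=> sorted_s s_lt_a /andP[lt_ab _].
apply: leq_trans (leq_bin2l _ lt_ab).
by rewrite binS addnC ltn_add2l IH.
Qed.

(** By [code_set_bound] and Pascal's rule, a sequence of size [n.+1] with last entry [a] has its
    code in the interval from ['C(a, n.+1)] up to, but excluding, ['C(a.+1, n.+1)]. These intervals
    are disjoint, so the code determines [a]. *)
Lemma code_set_inj s t : size s = size t -> sorted ltn s -> sorted ltn t ->
  code_set s = code_set t -> s = t.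
Proof.
elim/last_ind: s t => [|s a IH] t; first by case: t.
case/lastP: t => [|t b]; first by rewrite size_rcons.
rewrite !size_rcons !sorted_rcons_ltn !code_set_rcons => -[eq_sz].
case/andP=> sorted_s s_lt_a /andP[sorted_t t_lt_b] eq_code.
have lt_code u v x y : size u = size v -> sorted ltn u ->
    all (fun z => z < x) u -> x < y ->
    code_set u + 'C(x, (size u).+1) < code_set v + 'C(y, (size v).+1).
  move=> eq_uv sorted_u u_lt_x lt_xy; rewrite eq_uv.
  apply: leq_trans (leq_addl _ _); apply: leq_trans (leq_bin2l _ lt_xy).
  by rewrite binS addnC ltn_add2l -eq_uv code_set_bound.
have eq_ab : a = b.
  case: (ltngtP a b) => // lt_ab.
    by have := lt_code s t a b eq_sz sorted_s s_lt_a lt_ab; rewrite eq_code ltnn.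
  have := lt_code t s b a (esym eq_sz) sorted_t t_lt_b lt_ab.
  by rewrite eq_code ltnn.
move: eq_code; rewrite eq_ab eq_sz => /addIn eq_code.
by rewrite (IH t).
Qed.

(* Cantor pairing is the rank-two combinatorial number system. *)
Lemma cpairE x y : cpair x y = code_set [:: y; (x + y).+1].
Proof.
by rewrite /code_set /= !big_ord_recr big_ord0 /= add0n bin1 bin2 addnC mulnC.
Qed.

Lemma cpair_inj x y x' y' : cpair x y = cpair x' y' -> x = x' /\ y = y'.
Proof.
have sorted_pair u v : sorted ltn [:: v; (u + v).+1] by rewrite /= ltnS leq_addl.
rewrite !cpairE => eq_code.
have := @code_set_inj [:: y; (x + y).+1] [:: y'; (x' + y').+1] erefl.
by case/(_ (sorted_pair _ _) (sorted_pair _ _) eq_code) => -> /addIn ->.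
Qed.

(** * Oracle evaluation: inversion, determinism, finite use *)

(** The index [cpair x y] resists syntactic inversion, so equations are returned instead, to be
    split by [cpair_inj]. *)
Lemma evalR_inv A t x v : evalR A t x v ->
  match t with
  | TConst c => v = c
  | TSucc => v = x.+1
  | TId => v = x
  | TOracle => v = A x
  | TComp t1 t2 => exists2 y, evalR A t2 x y & evalR A t1 y v
  | TPair t1 t2 => exists a b, [/\ v = cpair a b, evalR A t1 x a & evalR A t2 x b]
  | TFst => exists y, x = cpair v y
  | TSnd => exists y, x = cpair y v
  | TPrec g h => exists y n, x = cpair y n /\
      if n is n'.+1 then exists2 u, evalR A (TPrec g h) (cpair y n') u
                                  & evalR A h (cpair (cpair y n') u) v
      else evalR A g y v
  | TMu t => evalR A t (cpair x v) 0 /\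
      forall z, z < v -> exists2 u, u != 0 & evalR A t (cpair x z) u
  end.
Proof.
case=> //.
- by move=> t1 t2 x' y z ev2 ev1; exists y.
- by move=> t1 t2 x' a b ev1 ev2; exists a, b.
- by move=> x' y; exists y.
- by move=> x' y; exists x'.
- by move=> g h x' v' ev; exists x', 0.
- by move=> g h x' n u w ev1 ev2; exists x', n.+1; split=> //; exists u.
Qed.

Lemma evalR_functional A t x v w : evalR A t x v -> evalR A t x w -> v = w.
Proof.
elim: t x v w => [c|||| t1 IH1 t2 IH2|t1 IH1 t2 IH2|||g IHg h IHh|t IH] x v w
  ev1 ev2.
1-4: by rewrite (evalR_inv ev1) (evalR_inv ev2).
- have [y ev11 ev12] := evalR_inv ev1; have [y' ev21 ev22] := evalR_inv ev2.
  by apply: IH1 ev12 _; rewrite (IH2 _ _ _ ev11 ev21).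
- have [a [b [-> ea eb]]] := evalR_inv ev1.
  have [a' [b' [-> ea' eb']]] := evalR_inv ev2.
  by rewrite (IH1 _ _ _ ea ea') (IH2 _ _ _ eb eb').
- have [y eq_x] := evalR_inv ev1; have [y' eq_x'] := evalR_inv ev2.
  by move: eq_x'; rewrite eq_x => /cpair_inj[].
- have [y eq_x] := evalR_inv ev1; have [y' eq_x'] := evalR_inv ev2.
  by move: eq_x'; rewrite eq_x => /cpair_inj[].
- have [y [n [eq_x _]]] := evalR_inv ev1.
  rewrite {x}eq_x in ev1 ev2; elim: n v w ev1 ev2 => [|n IHn] v w ev1 ev2.
    have [y1 [n1 [/cpair_inj[<- <-] ev1']]] := evalR_inv ev1.
    have [y2 [n2 [/cpair_inj[<- <-] ev2']]] := evalR_inv ev2.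
    exact: IHg ev1' ev2'.
  have [y1 [n1 [/cpair_inj[<- <-] [u1 evu1 ev1']]]] := evalR_inv ev1.
  have [y2 [n2 [/cpair_inj[<- <-] [u2 evu2 ev2']]]] := evalR_inv ev2.
  by apply: IHh ev1' _; rewrite (IHn _ _ evu1 evu2).
- have [ev1_0 ev1_lt] := evalR_inv ev1; have [ev2_0 ev2_lt] := evalR_inv ev2.
  case: (ltngtP v w) => // [/ev2_lt|/ev1_lt] [u u_neq0 ev_u].
    by rewrite (IH _ _ _ ev_u ev1_0) in u_neq0.
  by rewrite (IH _ _ _ ev_u ev2_0) in u_neq0.
Qed.

Definition agree (T : Type) (N : nat) (A B : nat -> T) := forall x, x < N -> A x = B x.

Lemma agree_le T N N' (A B : nat -> T) : N <= N' -> agree N' A B -> agree N A B.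
Proof. by move=> le_N eqAB x lt_x; apply: eqAB; exact: leq_trans le_N. Qed.

(** A halting computation makes finitely many queries. This continuity, with determinism, is all
    that is used of computability. *)
Lemma evalR_use A t x v : evalR A t x v ->
  exists N, forall B, agree N A B -> evalR B t x v.
Proof.
elim: t x v => [c|||| t1 IH1 t2 IH2|t1 IH1 t2 IH2|||g IHg h IHh|t IH] x v ev.
- by exists 0 => B _; rewrite (evalR_inv ev); constructor.
- by exists 0 => B _; rewrite (evalR_inv ev); constructor.
- by exists 0 => B _; rewrite (evalR_inv ev); constructor.
- by exists x.+1 => B eqAB; rewrite (evalR_inv ev) eqAB //; constructor.
- have [y /IH2[N2 ev2] /IH1[N1 ev1]] := evalR_inv ev.
  exists (maxn N1 N2) => B eqAB; apply: (ev_comp (y := y)).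
    by apply: ev2; apply: agree_le eqAB; exact: leq_maxr.
  by apply: ev1; apply: agree_le eqAB; exact: leq_maxl.
- have [a [b [-> /IH1[N1 ev1] /IH2[N2 ev2]]]] := evalR_inv ev.
  exists (maxn N1 N2) => B eqAB; constructor.
    by apply: ev1; apply: agree_le eqAB; exact: leq_maxl.
  by apply: ev2; apply: agree_le eqAB; exact: leq_maxr.
- by have [y ->] := evalR_inv ev; exists 0 => B _; constructor.
- by have [y ->] := evalR_inv ev; exists 0 => B _; constructor.
- have [y [n [eq_x _]]] := evalR_inv ev.
  rewrite {x}eq_x in ev *; elim: n v ev => [|n IHn] v ev.
    have [y1 [n1 [/cpair_inj[<- <-] /IHg[N evN]]]] := evalR_inv ev.
    by exists N => B eqAB; constructor; exact: evN.
  have [y1 [n1 [/cpair_inj[<- <-] [u /IHn[N1 ev1] /IHh[N2 ev2]]]]] := evalR_inv ev.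
  exists (maxn N1 N2) => B eqAB; apply: (ev_precS (v := u)).
    by apply: ev1; apply: agree_le eqAB; exact: leq_maxl.
  by apply: ev2; apply: agree_le eqAB; exact: leq_maxr.
- have [/IH[N0 ev0] ev_lt] := evalR_inv ev.
  have [N1 ev1] : exists N, forall B, agree N A B ->
      forall z, z < v -> exists2 u, u != 0 & evalR B t (cpair x z) u.
    elim: (v) ev_lt => [|w IHw] ev_lt; first by exists 0.
    have [z lt_z|N evN] := IHw; first by apply: ev_lt; exact: ltnW.
    have [u u_neq0 /IH[N' evN']] := ev_lt w (ltnSn w).
    exists (maxn N N') => B eqAB z; rewrite ltnS leq_eqVlt => /predU1P[->|lt_z].
      by exists u => //; apply: evN'; apply: agree_le eqAB; exact: leq_maxr.
    by apply: evN lt_z; apply: agree_le eqAB; exact: leq_maxl.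
  exists (maxn N0 N1) => B eqAB; constructor.
    by apply: ev0; apply: agree_le eqAB; exact: leq_maxl.
  by apply: ev1; apply: agree_le eqAB; exact: leq_maxr.
Qed.

Local Open Scope classical_set_scope.

(** * Homogeneous sets and finite tuples *)

Definition unbounded (X : nat -> Prop) := forall a, exists2 x, a <= x & X x.

Definition homogeneous (m : nat) (X : nat -> Prop) (f : seq nat -> nat) (c : nat) :=
  forall s, size s = m -> sorted ltn s -> (forall x, x \in s -> X x) -> f s = c.

(** Splitting off the largest entry, placed last, works for unsorted [l] too. *)
Fixpoint tuples (m : nat) (l : seq nat) : seq (seq nat) :=
  if m is m'.+1 then
    [seq rcons t y | y <- l, t <- tuples m' [seq x <- l | x < y]]
  else [:: [::]].

Lemma mem_tuples m l t :
  (t \in tuples m l) = [&& size t == m, sorted ltn t & all (mem l) t].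
Proof.
elim: m l t => [|m IH] l t; first by rewrite inE; case: t.
case/lastP: t => [|t y]; first by apply/allpairsPdep => -[y [t [_ _]]]; case: t.
rewrite size_rcons eqSS sorted_rcons_ltn all_rcons /=.
apply/allpairsPdep/idP => [[y' [t' [l_y tup_t /rcons_inj[-> ->]]]]|].
  move: tup_t; rewrite IH => /and3P[-> -> t_mem] /=; rewrite l_y /=.
  by rewrite -all_predI; apply: sub_all t_mem => x; rewrite !inE mem_filter.
case/and3P=> sz_t /andP[sorted_t t_lt] /andP[l_y t_l]; exists y, t; split=> //.
rewrite IH sz_t sorted_t /=; apply/allP => x t_x.
have l_x : x \in l := allP t_l x t_x.
by rewrite inE mem_filter (allP t_lt _ t_x).
Qed.

(** * Limits along an ultrafilter *)

Lemma nonprincipal_ultrafilter :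
  exists U : set_system nat, UltraFilter U /\ forall a, \forall n \near U, a <= n.
Proof.
have [U [ultraU sub_U]] := ultraFilterLemma eventually_filter.
by exists U; split=> // a; apply: sub_U; exists a.
Qed.

Section Ultrafilter.

Variables (U : set_system nat) (ultraU : UltraFilter U).
Hypothesis U_ge : forall a, \forall n \near U, a <= n.

Lemma near_const (P : Prop) : (\forall n \near U, P) -> P.
Proof. by move=> /filter_ex[]. Qed.

Lemma near_not (P : nat -> Prop) :
  ~ (\forall n \near U, P n) -> \forall n \near U, ~ P n.
Proof. by case: (in_ultra_setVsetC P ultraU). Qed.

Lemma near_seq (T : eqType) (P : T -> nat -> Prop) (s : seq T) :
  (forall t, t \in s -> \forall n \near U, P t n) ->
  \forall n \near U, forall t, t \in s -> P t n.
Proof.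
elim: s => [|t s IH] near_s; first exact: nearW.
have near_t : \forall n \near U, P t n by apply: near_s; exact: mem_head.
have /IH : forall t', t' \in s -> \forall n \near U, P t' n.
  by move=> t' s_t'; apply: near_s; rewrite inE s_t' orbT.
apply: filterS2 near_t => n Pt Ps t'; rewrite inE => /predU1P[->|] //.
exact: Ps.
Qed.

Lemma near_lt (P : nat -> nat -> Prop) N :
  (forall x, x < N -> \forall n \near U, P x n) ->
  \forall n \near U, forall x, x < N -> P x n.
Proof.
move=> near_N; have near_s : \forall n \near U, forall x, x \in iota 0 N -> P x n.
  by apply: near_seq => x; rewrite mem_iota => /near_N.
by apply: filterS near_s => n Pn x lt_x; apply: Pn; rewrite mem_iota.
Qed.

(** An ultrafilter settles each of the finitely many possible values. *)
Lemma ultralimit (x : nat -> nat) b :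
  (\forall n \near U, x n < b) -> exists2 v, v < b & \forall n \near U, x n = v.
Proof.
elim: b => [|b IH] near_x; first by case: (filter_ex near_x).
have [eq_b|] := pselect (\forall n \near U, x n = b); first by exists b.
move/near_not => neq_b; have [|v lt_v near_v] := IH.
  by apply: filterS2 near_x neq_b => n; rewrite ltnS leq_eqVlt => /predU1P[].
by exists v => //; exact: ltnW.
Qed.

Definition converges (T V : Type) (fs : nat -> T -> V) (f : T -> V) :=
  forall t, \forall n \near U, fs n t = f t.

Lemma converges_cst T V (f : T -> V) : converges (fun=> f) f.
Proof. by move=> t; exact: nearW. Qed.

(** Compactness of a product of finite spaces, over any index type. *)
Lemma ultralimit_fun (T : Type) (fs : nat -> T -> nat) b :
  (forall n t, fs n t < b) -> exists2 f, (forall t, f t < b) & converges fs f.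
Proof.
move=> lt_fs; have lim t : exists v, v < b /\ \forall n \near U, fs n t = v.
  have [|v lt_v near_v] := @ultralimit (fun n => fs n t) b; last by exists v.
  by apply: nearW => n; exact: lt_fs.
have [f f_lim] := choice lim.
by exists f => t; have [] := f_lim t.
Qed.

(** * Relaxed reductions on compact spaces of points *)

Variables j k : nat.

Definition name (f : seq nat -> nat) := forall s, f s < k.

(* [inst_of z] is the [k]-coloring named by [z], and [out T z] the set which the
   backward functional computes from the homogeneous set [T] of [col z].  Colorings
   are total on [seq nat]; only their values on increasing sequences of size [m]
   matter. *)
Record reduction (m : nat) := Reduction {
  point :> Type;
  cvg_point : (nat -> point) -> point -> Prop;
  inst_of : point -> seq nat -> nat;
  dom : point -> nat -> bool;
  col : point -> seq nat -> nat;
  out : (nat -> bool) -> point -> nat -> Prop;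
  cvg_cst : forall z, cvg_point (fun=> z) z;
  compact_point : forall zs, exists z, cvg_point zs z;
  inst_of_onto : forall f, name f -> exists z, inst_of z = f;
  inst_of_cvg : forall zs z, cvg_point zs z ->
    converges (fun n => inst_of (zs n)) (inst_of z);
  dom_cvg : forall zs z, cvg_point zs z -> converges (fun n => dom (zs n)) (dom z);
  dom_unbounded : forall z, unbounded (dom z);
  col_lt : forall z s, col z s < j;
  col_cvg : forall zs z, cvg_point zs z -> converges (fun n => col (zs n)) (col z);
  out_open : forall T zs z x, cvg_point zs z -> out T z x ->
    exists N, \forall n \near U, forall T', agree N T T' -> out T' (zs n) x;
  out_sol : forall (T : nat -> bool) z c, (forall x, T x -> dom z x) -> unbounded T ->
    homogeneous m T (col z) c ->
    unbounded (out T z) /\ exists c', homogeneous m (out T z) (inst_of z) c'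
}.

Lemma out_use m (Z : reduction m) T (z : Z) x :
  out T z x -> exists N, forall T', agree N T T' -> out T' z x.
Proof.
move=> Tx; have [N near_N] := out_open (cvg_cst z) Tx.
exists N; apply: near_const; exact: near_N.
Qed.

(** * Cylinders of colorings with a prescribed limit *)

Definition parent (s : seq nat) := take (size s).-1 s.

Lemma parent_rcons t y : parent (rcons t y) = t.
Proof. by rewrite /parent size_rcons -cats1 take_size_cat. Qed.

(** [pickle] is injective, so for a fixed [t] only finitely many [y] give a code below [N]. *)
Lemma pickle_rcons_large (t : seq nat) N :
  exists b, forall y, b <= y -> N <= pickle (rcons t y).
Proof.
elim: N => [|N [b le_b]]; first by exists 0.
have [[y0 eq_N]|neq_N] := pselect (exists y, pickle (rcons t y) = N).
  exists (maxn b y0.+1) => y; rewrite geq_max => /andP[/le_b le_N lt_y].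
  rewrite ltn_neqAle le_N andbT -eq_N; apply/eqP.
  by move=> /(pcan_inj pickleK)/rcons_inj[eq_y]; rewrite eq_y ltnn in lt_y.
exists b => y /le_b le_N; rewrite ltn_neqAle le_N andbT.
by apply/eqP => eq_N; apply: neq_N; exists y.
Qed.

(* [F] follows [h] on the sequences of code below [N], and from there on it has
   reached its limit [f] at the tuples of code below [l]. *)
Definition cylinder (f : seq nat -> nat) (l N : nat) (h F : seq nat -> nat) :=
  forall s, if pickle s < N then F s = h s
            else pickle (parent s) < l -> F s = f (parent s).

Lemma cylinder_le f l l' N h F :
  l <= l' -> cylinder f l' N h F -> cylinder f l N h F.
Proof.
move=> le_l cylF s; have := cylF s; case: ifP => // _ + lt_l.
by apply; exact: leq_trans le_l.
Qed.

Lemma cylinder_nonempty f l N h : name f -> name h ->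
  exists2 F, name F & cylinder f l N h F.
Proof.
move=> name_f name_h; exists (fun s => if pickle s < N then h s else f (parent s)).
  by move=> s; case: ifP.
by move=> s; case: (pickle s < N).
Qed.

Lemma cylinder_extend f l N N' h F0 F : N <= N' -> cylinder f l N h F0 ->
  cylinder f l N' F0 F -> cylinder f l N h F.
Proof.
move=> le_N cyl0 cylF s; have := cyl0 s; have := cylF s.
case: (ltnP (pickle s) N') => [lt_sN' -> //|le_N's].
by rewrite [pickle s < N]ltnNge (leq_trans le_N le_N's).
Qed.

(** * Deciding open facts, and the jump *)

Section Decide.

Variables (m : nat) (Z : reduction m).
Implicit Types (z : Z) (A : Z -> Prop).

Definition closed_set A :=
  forall zs z, cvg_point zs z -> (\forall n \near U, A (zs n)) -> A z.

Definition open_set A :=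
  forall zs z, cvg_point zs z -> A z -> \forall n \near U, A (zs n).

(** The forcing conditions: the closed set [A] still has a point over every coloring in the
    cylinder. *)
Record large f l N h A := Large {
  large_name : name h;
  large_closed : closed_set A;
  large_onto : forall F, name F -> cylinder f l N h F -> exists2 z, A z & inst_of z = F
}.

Lemma large_le f l l' N h A : l <= l' -> large f l N h A -> large f l' N h A.
Proof.
move=> le_l [name_h closedA ontoA]; split=> // F nameF cylF.
by apply: ontoA => //; exact: cylinder_le cylF.
Qed.

(** If the points of [A] outside every [O r] still lie over the whole cylinder, restrict to them.
    Otherwise some [F0] has over it only points of [A] satisfying some [O r]; by compactness
    finitely many values of [F0] force this, with a bound on [r], and these values get fixed. *)
Lemma decide f l N h A (O : nat -> Z -> Prop) :
  large f l N h A -> (forall r, open_set (O r)) ->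
  exists N' h' A' d, [/\ large f l N' h' A',
    forall z, A' z -> A z,
    forall F, cylinder f l N' h' F -> cylinder f l N h F &
    if d is Some R then forall z, A' z -> cylinder f l N' h' (inst_of z) ->
                          exists2 r, r <= R & O r z
    else forall z r, A' z -> ~ O r z].
Proof.
move=> largeA openO; have [name_h closedA ontoA] := largeA.
pose A1 z := A z /\ forall r, ~ O r z.
have closedA1 : closed_set A1.
  move=> zs z cvg_z near_A1; split=> [|r Or].
    by apply: closedA cvg_z _; apply: filterS near_A1 => n [].
  apply: near_const; apply: filterS2 near_A1 (openO _ _ _ cvg_z Or).
  by move=> n [_ nO] /nO.
have [largeA1|] := pselect (large f l N h A1).
  by exists N, h, A1, None; split=> //; move=> z; [case|move=> r [_]].
move=> not_large; have [F0 [nameF0 cylF0 F0_O]] : exists F0,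
    [/\ name F0, cylinder f l N h F0 &
        forall z, A z -> inst_of z = F0 -> exists r, O r z].
  apply: contrapT => noF0; apply: not_large; split=> // F nameF cylF.
  apply: contrapT => noz; apply: noF0; exists F; split=> // z Az eqF.
  apply: contrapT => noR; apply: noz; exists z => //; split=> // r Or.
  by apply: noR; exists r.
(* Otherwise counterexamples agreeing with [F0] on more and more values have a limit over [F0],
   which satisfies some [O r]; by openness so do counterexamples with [R >= r]. *)
have [R R_O] : exists R, forall z, A z ->
    (forall s, pickle s < R -> inst_of z s = F0 s) -> exists2 r, r <= R & O r z.
  apply: contrapT => noR.
  have bad R : exists z, [/\ A z, forall s, pickle s < R -> inst_of z s = F0 s &
      forall r, r <= R -> ~ O r z].
    apply: contrapT => noz; apply: noR; exists R => z Az eqF.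
    apply: contrapT => nor; apply: noz; exists z; split=> // r le_r Or.
    by apply: nor; exists r.
  have [zs zs_bad] := choice bad; have [z cvg_z] := compact_point zs.
  have Az : A z by apply: closedA cvg_z _; apply: nearW => n; case: (zs_bad n).
  have eqF : inst_of z = F0.
    apply/funext => s; apply: near_const.
    apply: filterS2 (U_ge (pickle s).+1) (inst_of_cvg cvg_z s) => n lt_n <-.
    by case: (zs_bad n) => _ ->.
  have [r Or] := F0_O z Az eqF.
  apply: near_const; apply: filterS2 (U_ge r) (openO _ _ _ cvg_z Or) => n le_n.
  by case: (zs_bad n) => _ _; apply.
have cyl_sub F : cylinder f l (maxn R N) F0 F -> cylinder f l N h F.
  by apply: cylinder_extend => //; exact: leq_maxr.
exists (maxn R N), F0, A, (Some R); split=> //.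
  by split=> // F nameF /cyl_sub; exact: ontoA.
move=> z Az cylz; apply: R_O => // s lt_s; have := cylz s.
by rewrite leq_max lt_s.
Qed.

Lemma decide_seq (T : eqType) (Q : T -> Z -> Prop) (q : seq T) f l N h A :
  large f l N h A -> (forall t, open_set (Q t)) ->
  exists N' h' A', [/\ large f l N' h' A',
    forall z, A' z -> A z,
    forall F, cylinder f l N' h' F -> cylinder f l N h F &
    forall t, t \in q -> (forall z, A' z -> ~ Q t z) \/
      (forall z, A' z -> cylinder f l N' h' (inst_of z) -> Q t z)].
Proof.
move=> largeA openQ; elim: q => [|t q [N1 [h1 [A1 [large1 sub1 cyl1 dec1]]]]].
  by exists N, h, A.
have [N2 [h2 [A2 [d [large2 sub2 cyl2 dec2]]]]] :=
  decide (O := fun=> Q t) large1 (fun=> openQ t).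
exists N2, h2, A2; split=> // [z /sub2/sub1|F /cyl2/cyl1|t'] //.
rewrite inE => /predU1P[->|/dec1[no_t|all_t]].
- case: d dec2 => [R|] dec2; [right=> z Az cylz|left=> z]; last exact: dec2 0.
  by have [] := dec2 z Az cylz.
- by left=> z /sub2; exact: no_t.
- by right=> z /sub2 Az /cyl2; exact: all_t.
Qed.

(** The decision at stage [l] sees [f] only through this finite part, hence is continuous in [f]. *)
Definition truncate l (f : seq nat -> nat) s := if pickle s < l then f s else 0.

Lemma cylinder_truncate f l N h F :
  cylinder (truncate l f) l N h F <-> cylinder f l N h F.
Proof.
by split=> cylF s; have := cylF s; case: ifP => // _; rewrite /truncate => + lt_l;
  rewrite lt_l; apply.
Qed.

Lemma truncate_cvg l fs f : converges fs f ->
  \forall n \near U, truncate l (fs n) = truncate l f.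
Proof.
move=> cvg_f; have near_lt_l : \forall n \near U, forall e, e < l ->
    forall s, pickle s = e -> fs n s = f s.
  apply: near_lt => e _; case eq_e: (@unpickle (seq nat) e) => [s|].
    apply: filterS (cvg_f s) => n eq_s t def_e.
    by move: eq_e; rewrite -def_e pickleK => -[->].
  by apply: nearW => n s def_e; move: eq_e; rewrite -def_e pickleK.
apply: filterS near_lt_l => n eq_n; apply/funext => s; rewrite /truncate.
by case: ifP => // lt_s; exact: (eq_n (pickle s)).
Qed.

(* The effective counterpart is the jump of a point together with the low basis
   theorem: each open fact about [z] is decided using finitely many values of [f],
   while [inst_of z] is made to converge to [f] in its last argument. *)
Lemma jump (O : nat -> nat -> Z -> Prop) :
  0 < k -> (forall e r, open_set (O e r)) ->
  exists (W : (seq nat -> nat) -> Z -> Prop) (d : (seq nat -> nat) -> nat -> option nat),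
  [/\ forall f, name f -> exists z, W f z,
      forall fs f zs z, name f -> converges fs f -> cvg_point zs z ->
        (forall n, W (fs n) (zs n)) -> W f z,
      forall fs f, converges fs f -> converges (fun n => d (fs n)) (d f),
      forall f z t, W f z ->
        exists N, forall y, N <= pickle (rcons t y) -> inst_of z (rcons t y) = f t
    & forall f z e, name f -> W f z ->
        if d f e is Some R then exists2 r, r <= R & O e r z else forall r, ~ O e r z].
Proof.
move=> k_gt0 openO; pose stage := (nat * (seq nat -> nat) * (Z -> Prop))%type.
pose lrg f l (st : stage) := large f l st.1.1 st.1.2 st.2.
pose cyl f l (st : stage) := cylinder f l st.1.1 st.1.2.
have step (q : nat * (seq nat -> nat) * stage) : exists r : stage * option nat,
    lrg q.1.2 q.1.1 q.2 -> [/\ lrg q.1.2 q.1.1 r.1,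
      forall z, r.1.2 z -> q.2.2 z,
      forall F, cyl q.1.2 q.1.1 r.1 F -> cyl q.1.2 q.1.1 q.2 F &
      if r.2 is Some R then forall z, r.1.2 z -> cyl q.1.2 q.1.1 r.1 (inst_of z) ->
                            exists2 r, r <= R & O q.1.1 r z
      else forall z r', r.1.2 z -> ~ O q.1.1 r' z].
  case: q => -[l f] st; have [lst|nlst] := pselect (lrg f l st).
    have [N' [h' [A' [d good]]]] := decide lst (openO l).
    by exists (N', h', A', d).
  by exists (st, None).
(* One choice for all inputs: colorings with the same truncations get the same stages and
   decisions. *)
have {step} [G G_good] := choice step.
pose st f := fix st l : stage :=
  if l is l'.+1 then (G (l', truncate l' f, st l')).1 else (0, fun=> 0, fun=> True).
pose d f l := (G (l, truncate l f, st f l)).2.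
have st_large f l : name f -> lrg f l (st f l).
  move=> name_f; elim: l => [|l IH].
    split=> // F nameF _.
    by have [z] := inst_of_onto Z nameF; exists z.
  have lst : lrg (truncate l f) l (st f l).
    have [? ? onto] := IH; split=> // F nameF /cylinder_truncate; exact: onto.
  have [[? ? onto] _ _ _] := G_good (l, truncate l f, st f l) lst.
  apply: large_le (leqnSn l) _; split=> // F nameF /cylinder_truncate; exact: onto.
have st_good f l : name f -> [/\
      forall z, (st f l.+1).2 z -> (st f l).2 z,
      forall F, cyl f l (st f l.+1) F -> cyl f l (st f l) F &
      if d f l is Some R then forall z, (st f l.+1).2 z ->
        cyl f l (st f l.+1) (inst_of z) -> exists2 r, r <= R & O l r z
      else forall z r', (st f l.+1).2 z -> ~ O l r' z].
  move=> name_f; have lst : lrg (truncate l f) l (st f l).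
    have [? ? onto] := st_large f l name_f.
    by split=> // F nameF /cylinder_truncate; exact: onto.
  have [_ sub_st sub_cyl dec] := G_good (l, truncate l f, st f l) lst.
  split=> //.
    move=> F /cylinder_truncate cylF; apply/cylinder_truncate; exact: sub_cyl.
  rewrite /d; move: dec; rewrite /=; case: (G _).2 => [R dec z Az cylz|//].
  by apply: dec => //; exact/cylinder_truncate.
have st_cvg fs f : converges fs f -> converges (fun n => st (fs n)) (st f).
  move=> cvg_f; elim=> [|l IH]; first exact: nearW.
  by apply: filterS2 IH (truncate_cvg l cvg_f) => n /= -> ->.
(* An intersection of nested closed conditions, nonempty by compactness. *)
pose W f z := forall l, (st f l).2 z /\ cyl f l (st f l) (inst_of z).
exists W, d; split.
- move=> f name_f; have stage_pt l : exists z, (st f l).2 z /\ cyl f l (st f l) (inst_of z).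
    have [name_h _ onto] := st_large f l name_f.
    have [F nameF cylF] := cylinder_nonempty l (st f l).1.1 name_f name_h.
    by have [z Az eqF] := onto F nameF cylF; exists z; rewrite eqF.
  have [zs zsP] := choice stage_pt; have [z cvg_z] := compact_point zs.
  have sub l i z' : (st f (i + l)).2 z' -> (st f l).2 z'.
    elim: i => //= i IH.
    by have [sub_st _ _] := st_good f (i + l) name_f; move/sub_st.
  have subc l i F : cyl f (i + l) (st f (i + l)) F -> cyl f l (st f l) F.
    elim: i => //= i IH; have [_ sub_cyl _] := st_good f (i + l) name_f.
    by move/(cylinder_le (leqnSn _))/sub_cyl.
  exists z => l; split.
    have [_ closedA _] := st_large f l name_f; apply: closedA cvg_z _.
    apply: filterS (U_ge l) => n le_n; apply: (sub l (n - l)); rewrite subnK //.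
    by case: (zsP n).
  move=> s; apply: near_const; apply: filterS2 (U_ge l) (inst_of_cvg cvg_z s) => n le_n <-.
  by apply: (subc l (n - l)); rewrite subnK //; case: (zsP n).
- move=> fs f zs z name_f cvg_f cvg_z Wn l; split.
    have [_ closedA _] := st_large f l name_f; apply: closedA cvg_z _.
    by apply: filterS (st_cvg _ _ cvg_f l) => n <-; case: (Wn n l).
  move=> s; apply: near_const.
  apply: filterS3 (st_cvg _ _ cvg_f l) (inst_of_cvg cvg_z s) (cvg_f (parent s)).
  by move=> n <- <- <-; have [_ /(_ s)] := Wn n l.
- move=> fs f cvg_f l; rewrite /d.
  by apply: filterS2 (st_cvg _ _ cvg_f l) (truncate_cvg l cvg_f) => n -> ->.
- move=> f z t Wz; have [_ cylz] := Wz (pickle t).+1.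
  exists (st f (pickle t).+1).1.1 => y le_y; have := cylz (rcons t y).
  by rewrite ltnNge le_y parent_rcons; apply.
- move=> f z e name_f Wz; have [_ _] := st_good f e name_f; have [Az cylz] := Wz e.+1.
  case: (d f e) => [R|] dec; last by move=> r; exact: dec.
  by apply: dec => //; exact: cylinder_le cylz.
Qed.

End Decide.

(** * Prehomogeneous sets: from [m.+1] to [m] *)

Section Lower.

Variables (m : nat) (Z : reduction m.+1).

Fixpoint greedy (z : Z) (lam : seq nat -> nat) (a : nat) : seq nat :=
  if a is b.+1 then
    if dom z b && all (fun t => col z (rcons t b) == lam t) (tuples m (greedy z lam b))
    then rcons (greedy z lam b) b else greedy z lam b
  else [::].

(* Greedily built, hence determined by finitely many values of [col z] and [lam]. *)
Definition prehom z lam x := x \in greedy z lam x.+1.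

Lemma mem_greedy z lam a x : (x \in greedy z lam a) = (x < a) && prehom z lam x.
Proof.
rewrite /prehom; elim: a => [|a IH]; first by rewrite in_nil ltn0.
rewrite ltnS leq_eqVlt; have [->|neq_xa] /= := eqVneq x a; first by [].
by rewrite -IH; case: ifP => // _; rewrite mem_rcons inE (negPf neq_xa).
Qed.

Lemma prehomE z lam x : prehom z lam x =
  dom z x && all (fun t => col z (rcons t x) == lam t) (tuples m (greedy z lam x)).
Proof.
rewrite {1}/prehom /=; case: ifP => _; first by rewrite mem_rcons mem_head.
by rewrite mem_greedy ltnn.
Qed.

Lemma greedy_cvg zs z lams lam : cvg_point zs z -> converges lams lam ->
  converges (fun n => greedy (zs n) (lams n)) (greedy z lam).
Proof.
move=> cvg_z cvg_lam; elim=> [|a IH]; first exact: nearW.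
have near_t : \forall n \near U, forall t, t \in tuples m (greedy z lam a) ->
    (col (zs n) (rcons t a) == lams n t) = (col z (rcons t a) == lam t).
  apply: near_seq => t _.
  by apply: filterS2 (col_cvg cvg_z (rcons t a)) (cvg_lam t) => n -> ->.
apply: filterS3 IH (dom_cvg cvg_z a) near_t => n /= -> -> eq_t.
by rewrite (eq_in_all eq_t).
Qed.

(* Codes the question whether [greedy z lam a] can be prolonged at or above [a]. *)
Definition query z lam a : nat :=
  pickle (a, [seq (t, lam t) | t <- tuples m (greedy z lam a)]).

Lemma query_cvg zs z lams lam : cvg_point zs z -> converges lams lam ->
  converges (fun n => query (zs n) (lams n)) (query z lam).
Proof.
move=> cvg_z cvg_lam a.
have near_t : \forall n \near U, forall t, t \in tuples m (greedy z lam a) ->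
    (t, lams n t) = (t, lam t).
  by apply: near_seq => t _; apply: filterS (cvg_lam t) => n ->.
apply: filterS2 (greedy_cvg cvg_z cvg_lam a) near_t => n eq_g eq_t.
by rewrite /query eq_g; congr (pickle (a, _)); exact/eq_in_map.
Qed.

(** The code [e] carries the finite data on [lam], so this is an open condition on [z] alone, which
    [jump] can decide. *)
Definition answer (e r : nat) (z : Z) : Prop :=
  if @unpickle (nat * seq (seq nat * nat))%type e is Some (a, l) then
    [/\ a <= r, dom z r & forall p, p \in l -> col z (rcons p.1 r) = p.2]
  else False.

Lemma answer_open e r : open_set (answer e r).
Proof.
rewrite /answer => zs z cvg_z; case: unpickle => [[a l]|//] [le_a dom_r col_l].
have near_l : \forall n \near U, forall p, p \in l -> col (zs n) (rcons p.1 r) = p.2.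
  apply: near_seq => p l_p.
  by apply: filterS (col_cvg cvg_z (rcons p.1 r)) => n ->; exact: col_l.
by apply: filterS2 near_l (dom_cvg cvg_z r) => n ? ->.
Qed.

Lemma answer_query z lam a r : answer (query z lam a) r z <->
  [&& a <= r, dom z r &
      all (fun t => col z (rcons t r) == lam t) (tuples m (greedy z lam a))].
Proof.
rewrite /answer /query pickleK; split=> [[le_a dom_r col_r]|/and3P[le_a dom_r col_r]].
  rewrite le_a dom_r; apply/allP => t tup_t; apply/eqP.
  by apply: (col_r (t, lam t)); exact: map_f.
by split=> // _ /mapP[t tup_t ->] /=; apply/eqP; exact: (allP col_r).
Qed.

Lemma prehom_tuple z lam c (T : nat -> bool) : (forall x, T x -> prehom z lam x) ->
  homogeneous m T lam c -> homogeneous m.+1 T (col z) c.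
Proof.
move=> sub_T hom_T s; case/lastP: s => [//|t y]; rewrite size_rcons => -[sz_t].
rewrite sorted_rcons_ltn => /andP[sorted_t t_lt_y] T_ty.
have T_t x : x \in t -> T x by move=> t_x; apply: T_ty; rewrite mem_rcons inE t_x orbT.
have /sub_T : T y by apply: T_ty; rewrite mem_rcons mem_head.
rewrite prehomE => /andP[_ /allP/(_ t)]; rewrite (hom_T t) // => /(_ _)/eqP; apply.
rewrite mem_tuples sz_t eqxx sorted_t /=; apply/allP => x t_x.
by rewrite inE mem_greedy (allP t_lt_y _ t_x) sub_T ?T_t.
Qed.

Lemma prehom_next z lam a R : (exists2 r, r <= R & answer (query z lam a) r z) ->
  exists2 r, a <= r <= R & prehom z lam r.
Proof.
move=> [r0 le_r0 /answer_query ans_r0]; have ex_r : exists r, [&& a <= r, dom z r &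
    all (fun t => col z (rcons t r) == lam t) (tuples m (greedy z lam a))].
  by exists r0.
case: (ex_minnP ex_r) => r /and3P[le_ar dom_r col_r] r_least.
exists r; first by rewrite le_ar (leq_trans (r_least _ ans_r0)).
rewrite prehomE dom_r /=; suff -> : greedy z lam r = greedy z lam a by [].
rewrite -(subnKC le_ar); have: a + (r - a) <= r by rewrite subnKC.
elim: (r - a) => [|i IH] le_i; first by rewrite addn0.
rewrite addnS in le_i *; rewrite /= IH ?(ltnW le_i) //; case: ifP => // /andP[dom_i col_i].
by have := r_least (a + i); rewrite leq_addr dom_i col_i leqNgt le_i => /(_ isT).
Qed.

(** New points are triples of a coloring [f], a point [z] over a coloring with limit [f], and
    predictions [lam], which become the new [j]-coloring on the prehomogeneous set. *)
Lemma lower : 0 < k -> inhabited (reduction m).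
Proof.
move=> k_gt0; have [W [d [W_ex W_closed d_cvg W_lim W_dec]]] := jump k_gt0 answer_open.
(* Mere unboundedness would not survive limits; the bound given by [d] is continuous in all data, so
   the condition is closed. *)
pose ok (w : (seq nat -> nat) * Z * (seq nat -> nat)) :=
  [/\ name w.1.1, W w.1.1 w.1.2, forall t, w.2 t < j &
      forall a, exists2 r, a <= r <= odflt 0 (d w.1.1 (query w.1.2 w.2 a)) &
        prehom w.1.2 w.2 r].
pose pt := {w | ok w}.
pose cv (ws : nat -> pt) (w : pt) := [/\
  converges (fun n => (sval (ws n)).1.1) (sval w).1.1,
  cvg_point (fun n => (sval (ws n)).1.2) (sval w).1.2 &
  converges (fun n => (sval (ws n)).2) (sval w).2].
have prehom_cvg ws w : cv ws w -> converges
    (fun n => prehom (sval (ws n)).1.2 (sval (ws n)).2) (prehom (sval w).1.2 (sval w).2).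
  move=> [_ cvg_z cvg_lam] x.
  by apply: filterS (greedy_cvg cvg_z cvg_lam x.+1) => n; rewrite /prehom => ->.
constructor; refine (@Reduction m pt cv (fun w => (sval w).1.1)
  (fun w => prehom (sval w).1.2 (sval w).2) (fun w => (sval w).2)
  (fun T w => out T (sval w).1.2) _ _ _ _ _ _ _ _ _ _).
- by move=> w; split; [exact: converges_cst|exact: cvg_cst|exact: converges_cst].
- move=> ws.
  have [f name_f cvg_f] : exists2 f, name f & converges (fun n => (sval (ws n)).1.1) f.
    by apply: ultralimit_fun => n t; case: (svalP (ws n)).
  have [z cvg_z] := compact_point (fun n => (sval (ws n)).1.2).
  have [lam lt_lam cvg_lam] : exists2 lam, (forall t, lam t < j) &
      converges (fun n => (sval (ws n)).2) lam.
    by apply: ultralimit_fun => n t; case: (svalP (ws n)).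
  have ok_w : ok (f, z, lam).
    split=> //=.
      by apply: W_closed name_f cvg_f cvg_z _ => n; case: (svalP (ws n)).
    move=> a; set R := odflt _ _.
    have near_R : \forall n \near U,
        odflt 0 (d (sval (ws n)).1.1 (query (sval (ws n)).1.2 (sval (ws n)).2 a)) = R.
      apply: filterS2 (query_cvg cvg_z cvg_lam a) (d_cvg _ _ cvg_f (query z lam a)).
      by move=> n -> ->.
    have near_X : \forall n \near U, forall x, x < R.+1 ->
        prehom (sval (ws n)).1.2 (sval (ws n)).2 x = prehom z lam x.
      apply: near_lt => x _.
      by apply: filterS (greedy_cvg cvg_z cvg_lam x.+1) => n; rewrite /prehom => ->.
    apply: near_const; apply: filterS2 near_R near_X => n eq_R eq_X.
    have [_ _ _ /(_ a)[r]] := svalP (ws n); rewrite eq_R => le_r X_r.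
    by exists r => //; rewrite -eq_X // ltnS; case/andP: le_r.
  by exists (exist _ _ ok_w).
- move=> f name_f; have [z Wz] := W_ex f name_f.
  have dom_ge n : exists x, n <= x /\ dom z x.
    by have [x] := dom_unbounded z n; exists x.
  have [dn dnP] := choice dom_ge.
  (* The predictions are the limit colors along elements of the domain tending to infinity. *)
  have [lam lt_lam cvg_lam] : exists2 lam, (forall t, lam t < j) &
      converges (fun n t => col z (rcons t (dn n))) lam.
    by apply: ultralimit_fun => n t; exact: col_lt.
  suff ok_w : ok (f, z, lam) by exists (exist _ _ ok_w).
  split=> //= a; set R := odflt _ _; apply: prehom_next.
  have [r ans_r] : exists r, answer (query z lam a) r z.
    have near_t : \forall n \near U, forall t, t \in tuples m (greedy z lam a) ->
        col z (rcons t (dn n)) = lam t by apply: near_seq => t _; exact: cvg_lam.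
    (* One far element [dn n] fulfils the finitely many predictions at once, so the query has an
       answer. *)
    have [n [col_n le_n]] := filter_ex (filterI near_t (U_ge a)).
    have [le_dn dom_n] := dnP n; exists (dn n); apply/answer_query.
    rewrite (leq_trans le_n) // dom_n; apply/allP => t tup_t.
    by apply/eqP; exact: col_n.
  by have := W_dec f z (query z lam a) name_f Wz; rewrite /R; case: (d f _) => // /(_ r).
- by move=> ws w [].
- exact: prehom_cvg.
- by move=> w a; have [_ _ _ /(_ a)[r /andP[le_a _]]] := svalP w; exists r.
- by move=> w; case: (svalP w).
- by move=> ws w [].
- by move=> T ws w x [_ cvg_z _]; exact: out_open.
- move=> T w c sub_T inf_T hom_T; have [name_f Wz _ _] := svalP w.
  have sub_dom x : T x -> dom (sval w).1.2 x.
    by move=> /sub_T; rewrite prehomE => /andP[].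
  have [inf_out [c' hom_out]] := out_sol sub_dom inf_T (prehom_tuple sub_T hom_T).
  split=> //; exists c' => t sz_t sorted_t out_t.
  (* A large output [y] lies beyond [t] and where the coloring has reached [f t], so homogeneity at
     [rcons t y] determines [f t]. *)
  have [N lim_t] := W_lim _ _ t Wz.
  have [b [le_b lt_b]] : exists b, (forall y, b <= y -> N <= pickle (rcons t y)) /\
      all (fun x => x < b) t.
    have [b le_b] := pickle_rcons_large t N.
    exists (maxn b (\max_(x <- t) x).+1); split=> [y|].
      by rewrite geq_max => /andP[/le_b].
    by apply/allP => x t_x; rewrite leq_max ltnS leq_bigmax_seq ?orbT.
  have [y le_y out_y] := inf_out b.
  rewrite -(lim_t y) ?le_b //; apply: hom_out; first by rewrite size_rcons sz_t.
    rewrite sorted_rcons_ltn sorted_t; apply/allP => x t_x.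
    exact: leq_trans (allP lt_b _ t_x) le_y.
  by move=> x; rewrite mem_rcons inE => /predU1P[->|/out_t].
Qed.

End Lower.

(** * The base case: colorings of numbers *)

Lemma reduction1_false (Z : reduction 1) : j < k -> False.
Proof.
move=> lt_jk; have k_gt0 : 0 < k := leq_ltn_trans (leq0n j) lt_jk.
pose Q (p : nat * nat) (z : Z) := exists (F : seq nat) x,
  [/\ forall y, y \in F -> dom z y /\ col z [:: y] = p.1,
      out (fun y => y \in F) z x & inst_of z [:: x] = p.2].
have openQ p : open_set (Q p).
  move=> zs z cvg_z [F [x [F_col out_x inst_x]]].
  have near_F : \forall n \near U, forall y, y \in F ->
      dom (zs n) y /\ col (zs n) [:: y] = p.1.
    apply: near_seq => y /F_col[dom_y col_y].
    by apply: filterS2 (dom_cvg cvg_z y) (col_cvg cvg_z [:: y]) => n -> ->.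
  have [N near_out] := out_open cvg_z out_x.
  apply: filterS3 near_F near_out (inst_of_cvg cvg_z [:: x]) => n ? out_n inst_n.
  by exists F, x; split=> //; [exact: out_n|rewrite inst_n].
(* At level [l = 0] a cylinder fixes finitely many values and prescribes no limit. *)
have large0 : large (fun=> 0) 0 0 (fun=> 0) (fun _ : Z => True).
  by split=> // F nameF _; have [z] := inst_of_onto Z nameF; exists z.
have [N [h [A [[name_h _ onto] _ _ dec]]]] :=
  decide_seq [seq (c, i) | c <- iota 0 j, i <- iota 0 k] large0 openQ.
pose yes c i := forall z, A z -> cylinder (fun=> 0) 0 N h (inst_of z) -> Q (c, i) z.
have choose_i c : exists i, (exists2 i, i < k & yes c i) -> yes c i.
  have [[i _ yes_i]|no_i] := pselect (exists2 i, i < k & yes c i); last by exists 0.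
  by exists i.
have [chosen chosenP] := choice choose_i.
have [i0 lt_i0 i0_new] : exists2 i, i < k & i \notin [seq chosen c | c <- iota 0 j].
  apply: contrapT => all_used.
  have : size (iota 0 k) <= size [seq chosen c | c <- iota 0 j].
    apply: uniq_leq_size (iota_uniq 0 k) _ => i; rewrite mem_iota => lt_i.
    by apply: contrapT => new_i; apply: all_used; exists i => //; exact/negP.
  by rewrite size_map !size_iota leqNgt lt_jk.
pose b s := if pickle s < N then h s else i0.
have name_b : name b by move=> s; rewrite /b; case: ifP.
have cyl_b : cylinder (fun=> 0) 0 N h b by move=> s; rewrite /b; case: (pickle s < N).
have [z Az eq_b] := onto b name_b cyl_b.
have dom_ge n : exists x, n <= x /\ dom z x.
  by have [x] := dom_unbounded z n; exists x.
have [dn dnP] := choice dom_ge.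
have [c lt_c near_c] : exists2 c, c < j & \forall n \near U, col z [:: dn n] = c.
  by apply: ultralimit; apply: nearW => n; exact: col_lt.
pose T y := dom z y && (col z [:: y] == c).
have T_large a : exists2 y, a <= y & T y.
  have [n [col_n le_n]] := filter_ex (filterI near_c (U_ge a)).
  have [le_dn dom_n] := dnP n; exists (dn n); first exact: leq_trans le_dn.
  by rewrite /T dom_n col_n eqxx.
(* The output is infinite and of a single color, and its elements with code at least [N] have color
   [i0]. *)
have sol (T' : nat -> bool) : (forall y, T' y -> T y) -> unbounded T' ->
    unbounded (out T' z) /\ forall x, out T' z x -> inst_of z [:: x] = i0.
  move=> sub_T inf_T; have [||inf_out [i hom_i]] := @out_sol _ Z T' z c _ inf_T.
  - by move=> y /sub_T/andP[].
  - move=> [|y [|y' s]] //= _ _ T_y; have /sub_T/andP[_ /eqP] // : T' y.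
    by apply: T_y; exact: mem_head.
  have out_i x : out T' z x -> inst_of z [:: x] = i.
    by move=> out_x; apply: hom_i => // y; rewrite inE => /eqP->.
  split=> // x /out_i ->; have [b0 le_b0] := pickle_rcons_large [::] N.
  have [y /le_b0 le_N out_y] := inf_out b0.
  by rewrite -(out_i y out_y) eq_b /b ltnNge le_N.
(* The part of [T] below the use of one output is a finite set refuting a negative decision for
   [(c, i0)]. *)
have yes_i0 : yes c i0.
  have [|no_Q|//] := dec (c, i0).
    by apply: allpairs_f; rewrite mem_iota.
  have [inf_out out_i0] := sol T (fun=> id) T_large; have [x _ out_x] := inf_out 0.
  have [N' out_N'] := out_use out_x.
  case: (no_Q z Az); exists [seq y <- iota 0 N' | T y], x; split.
  - by move=> y; rewrite mem_filter => /andP[/andP[-> /eqP->]].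
  - by apply: out_N' => y lt_y; rewrite mem_filter mem_iota leq0n lt_y !andbT.
  - exact: out_i0.
have [||F [x [F_col out_x inst_x]]] := chosenP c _ z Az; first by exists i0.
  by rewrite eq_b.
have [N' out_N'] := out_use out_x.
(* Continuing [F] by [T] beyond the use keeps the output [x] of color [chosen c], whereas all
   outputs must have color [i0]. *)
pose T' y := if y < N' then y \in F else T y.
have [|| _ /(_ x)] := sol T'.
- move=> y; rewrite /T'; case: ifP => // _ /F_col[dom_y /= col_y].
  by rewrite /T dom_y col_y eqxx.
- move=> a; have [y] := T_large (maxn a N'); rewrite geq_max => /andP[le_a le_N] T_y.
  by exists y => //; rewrite /T' ltnNge le_N.
rewrite inst_x => /(_ _)/= eq_i; move/negP: i0_new; apply; rewrite -eq_i.
  by apply: map_f; rewrite mem_iota.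
by apply: out_N' => y lt_y; rewrite /T' lt_y.
Qed.

End Ultrafilter.

(** * From Turing functionals to relaxed reductions *)

(** Points are the colorings themselves, the domain is all of [nat], and [out] collects the inputs
    where [Psi] returns 1. *)
Lemma sW_reducible_reduction (U : set_system nat) (ultraU : UltraFilter U) n j k :
  sW_reducible (RT n k) (RT n j) -> inhabited (reduction U j k n).
Proof.
move=> [Phi [Psi red]].
(* Yields a left inverse of [code_set] on increasing sequences of size [n], turning colorings of
   sequences into oracles. *)
have decode x : exists s, forall t, size t = n -> sorted ltn t -> code_set t = x -> t = s.
  have [[s [sz_s sorted_s code_s]]|no_s] :=
    pselect (exists s, [/\ size s = n, sorted ltn s & code_set s = x]).
    exists s => t sz_t sorted_t code_t.
    by apply: code_set_inj => //; rewrite ?sz_t ?code_t.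
  by exists [::] => t sz_t sorted_t code_t; case: no_s; exists t.
have [dec decP] := choice decode.
pose pt := {f | name k f}; pose A (w : pt) x := sval w (dec x).
have A_code w s : size s = n -> sorted ltn s -> A w (code_set s) = sval w s.
  by move=> sz_s sorted_s; rewrite /A -(decP _ s).
have inst_A w : inst (RT n k) (A w) by move=> x; exact: svalP w _.
have red_w w : exists B, computes Phi (A w) B /\ inst (RT n j) B /\
  forall T, sol (RT n j) B T -> exists C, computes Psi T C /\ sol (RT n k) (A w) C.
  exact: red.
have [B BP] := choice red_w.
constructor; refine (@Reduction U j k n pt
  (fun ws w => converges U (fun n => sval (ws n)) (sval w)) (fun w => sval w)
  (fun _ _ => true) (fun w s => B w (code_set s))
  (fun T _ x => evalR (fun y => T y : nat) Psi x 1) _ _ _ _ _ _ _ _ _ _).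
- by move=> w; exact: converges_cst.
- move=> ws; have [f name_f cvg_f] := ultralimit_fun ultraU (fun n => svalP (ws n)).
  by exists (exist _ f name_f).
- by move=> f name_f; exists (exist _ f name_f).
- by [].
- by move=> ws w _ x; exact: nearW.
- by move=> w a; exists a.
- by move=> w s; have [_ []] := BP w.
- move=> ws w cvg_w s; have [Phi_w _] := BP w.
  have [N use_N] := evalR_use (Phi_w (code_set s)).
  have near_A : \forall n \near U, forall x, x < N -> A w x = A (ws n) x.
    by apply: near_lt => x _; apply: filterS (cvg_w (dec x)) => i; rewrite /A => ->.
  apply: filterS near_A => i /use_N; apply: evalR_functional.
  by have [Phi_i _] := BP (ws i).
- move=> T ws w x _ /evalR_use[N use_N]; exists N; apply: nearW => i T' eq_T.
  by apply: use_N => y lt_y; rewrite eq_T.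
- move=> T w c _ inf_T hom_T; have [_ [_ /(_ (fun y => T y : nat))[]]] := BP w.
    split; first by move=> y; exact: leq_b1.
      by move=> a; have [y le_y T_y] := inf_T a; exists y => //; rewrite T_y.
    exists c => s [sz_s sorted_s T_s]; apply: hom_T => // y s_y.
    by have := allP T_s y s_y; case: (T y).
  move=> C [Psi_C [_ inf_C [c' hom_C]]]; split=> [a|].
    by have [y le_y C_y] := inf_C a; exists y => //; rewrite -C_y; exact: Psi_C.
  exists c' => s sz_s sorted_s out_s; rewrite -A_code //; apply: hom_C; split=> //.
  by apply/allP => y /out_s out_y; apply/eqP; exact: evalR_functional (Psi_C y) out_y.
Qed.

Theorem theorem3p1 :
  forall n j k : nat, 1 <= n -> 2 <= j -> j < k ->
    ~ sW_reducible (RT n k) (RT n j).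
Proof.
move=> n j k n_gt0 j_gt1 lt_jk red.
have k_gt0 : 0 < k := leq_ltn_trans (leq0n j) lt_jk.
have [U [ultraU U_ge]] := nonprincipal_ultrafilter.
have [Z] := sW_reducible_reduction ultraU red.
case: n n_gt0 Z {red} => // n _; elim: n => [|n IH] Z.
  exact: (reduction1_false ultraU U_ge Z).
by have [Z'] := lower ultraU U_ge Z k_gt0; exact: IH.
Qed.
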